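(* Let $M$ be a matroid on a finite ground set $E$. Then its independence complex $IN(M)$ satisfies the spectral recursion; that is, for $\Delta = IN(M)$ and for every $e\in E$, $$S_\Delta(t,q) = q\,S_{\Delta-e}(t,q) + qt\,S_{\Delta/e}(t,q) + (1-q)\,S_{(\Delta-e,\Delta/e)}(t,q).$$
   Context: A simplicial complex $\Delta$ on a finite vertex set $V$ is a collection of subsets of $V$ (faces) closed under taking subsets. The empty set is a face (of dimension $-1$) of every complex that has at least one face; the empty complex $\emptyset$ (no faces at all) is allowed; an element $v\in V$ need not satisfy $\{v\}\in\Delta$. Put $\dim F=|F|-1$. A simplicial pair $(\Delta,\Delta')$ consists of two simplicial complexes on the same vertex set; pairs with the same set difference $\Delta\setminus\Delta'$ are identified, and a single complex $\Delta$ is the pair $(\Delta,\emptyset)$. For $i\ge -1$, $C_i(\Delta,\Delta';\mathbb R)$ is the real vector space of formal linear combinations of oriented $i$-dimensional faces $[F]$, $F\in\Delta\setminus\Delta'$, and $\partial_i\colon C_i\to C_{i-1}$ is the usual signed simplicial boundary operator with all terms outside $\Delta\setminus\Delta'$ dropped; $\partial_i^*$ is its adjoint (transposed matrix in the natural bases). The Laplacian is $L_i(\Delta,\Delta')=\partial_{i+1}\partial_{i+1}^*+\partial_i^*\partial_i$, and $\mathbf s_i(\Delta,\Delta')$ is the multiset of its eigenvalues (non-negative reals). The spectrum polynomial is the generating function $$S_{(\Delta,\Delta')}(t,q)=\sum_{i\ge 0}t^i\sum_{\lambda\in\mathbf s_{i-1}(\Delta,\Delta')}q^\lambda,\qquad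 S_\Delta=S_{(\Delta,\emptyset)}$$ (exponents of $q$ may a priori be arbitrary non-negative reals). For $e\in V$, the deletion $\Delta-e=\{F\in\Delta: e\notin F\}$ and the contraction $\Delta/e=\{F\setminus\{e\}: F\in\Delta,\ e\in F\}$ are simplicial complexes on vertex set $V\setminus\{e\}$. The independence complex $IN(M)$ of a matroid $M$ on $E$ is the simplicial complex with vertex set $E$ (loops of $M$ included in the vertex set) whose faces are the independent sets of $M$. *)

(* Defs.v *)
From HB Require Import structures.
From mathcomp Require Import all_boot all_order all_algebra.
From mathcomp Require Import polyrcf.
From mathcomp Require Import monalg.

Set Implicit Arguments.
Unset Strict Implicit.
Unset Printing Implicit Defensive.

Import Order.TTheory GRing.Theory Num.Theory.

Local Open Scope ring_scope.

(* ** Simplicial complexes and pairs *)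

(* The vertex set V is a subset of an ambient finite type T.  Complexes may be
   empty (no faces at all), and a vertex v need not give a face [set v]. *)
Record scomplex (T : finType) := SComplex {
  vset : {set T};
  faces : {set {set T}};
  faces_sub : forall F, F \in faces -> F \subset vset;
  faces_down : forall F G : {set T}, F \in faces -> G \subset F -> G \in faces
}.

Section Complexes.
Context {T : finType}.
Implicit Types (D : scomplex T) (V : {set T}) (e : T).

Lemma empty_faces_sub V (F : {set T}) :
  F \in (set0 : {set {set T}}) -> F \subset V.
Proof. by rewrite inE. Qed.

Lemma empty_faces_down (F G : {set T}) :
  F \in (set0 : {set {set T}}) -> G \subset F ->
  G \in (set0 : {set {set T}}).
Proof. by rewrite inE. Qed.

Definition empty_complex V : scomplex T :=
  SComplex (@empty_faces_sub V) empty_faces_down.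

Definition deletion_faces D e : {set {set T}} :=
  [set F in faces D | e \notin F].

Lemma deletion_faces_sub D e (F : {set T}) :
  F \in deletion_faces D e -> F \subset vset D :\ e.
Proof. by rewrite inE subsetD1 => /andP[/faces_sub -> ->]. Qed.

Lemma deletion_faces_down D e (F G : {set T}) :
  F \in deletion_faces D e -> G \subset F -> G \in deletion_faces D e.
Proof.
rewrite !inE => /andP[DF eF] sGF; rewrite (faces_down DF sGF) /=.
by apply: contra eF => /(subsetP sGF).
Qed.

Definition deletion D e : scomplex T :=
  SComplex (@deletion_faces_sub D e) (@deletion_faces_down D e).

Definition contraction_faces D e : {set {set T}} :=
  [set F :\ e | F in [set F in faces D | e \in F]].

Lemma contraction_faces_sub D e (F : {set T}) :
  F \in contraction_faces D e -> F \subset vset D :\ e.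
Proof.
case/imsetP => F'; rewrite inE => /andP[DF _] ->.
by rewrite setSD // faces_sub.
Qed.

Lemma contraction_faces_down D e (F G : {set T}) :
  F \in contraction_faces D e -> G \subset F -> G \in contraction_faces D e.
Proof.
case/imsetP => F'; rewrite inE => /andP[DF eF] ->.
rewrite subsetD1 => /andP[sGF eG]; apply/imsetP; exists (e |: G).
  rewrite inE setU11 andbT; apply: faces_down DF _.
  by rewrite subUset sub1set eF.
by rewrite setU1K.
Qed.

Definition contraction D e : scomplex T :=
  SComplex (@contraction_faces_sub D e) (@contraction_faces_down D e).

End Complexes.

Record spair (T : finType) := SPair {
  spair_big : scomplex T;
  spair_small : scomplex T;
  spair_vset : vset spair_big = vset spair_small
}.

Section Pairs.
Context {T : finType}.
Implicit Types (D : scomplex T) (e : T).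

Definition spair_of_complex D : spair T :=
  @SPair T D (empty_complex (vset D)) erefl.

Definition del_con_pair D e : spair T :=
  @SPair T (deletion D e) (contraction D e) erefl.

End Pairs.

Coercion spair_of_complex : scomplex >-> spair.

(* ** Laplacians and their spectra

   Throughout, chain groups are indexed by the cardinality k = i + 1 of the
   faces instead of their dimension i >= -1. *)

Section Laplacian.
Context {R : rcfType} {T : finType}.
Implicit Types (P : spair T) (F G : {set T}).

Definition cells P (k : nat) : {set {set T}} :=
  [set F in faces (spair_big P) :\: faces (spair_small P) | #|F| == k].

(* Faces are oriented by the enumeration order of T.  The coefficient of [G]
   in the boundary of [F] is (-1)^j if G is F minus its j-th vertex (counting
   from 0), and 0 if G is not of this form. *)
Definition boundary_coef G F : R :=
  \sum_(x in F | F :\ x == G)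
    (-1) ^+ #|[set y in F | (enum_rank y < enum_rank x)%N]|.

(* The matrix of the boundary map from chains on faces of cardinality k + 1 to
   chains on faces of cardinality k, acting on column vectors. *)
Definition boundary P k : 'M[R]_(#|cells P k|, #|cells P k.+1|) :=
  \matrix_(i, j) boundary_coef (enum_val i) (enum_val j).

Definition down_laplacian P k : 'M[R]_#|cells P k| :=
  match k with
  | 0 => 0
  | k'.+1 => (boundary P k')^T *m boundary P k'
  end.

Definition laplacian P k : 'M[R]_#|cells P k| :=
  boundary P k *m (boundary P k)^T + down_laplacian P k.

(* The multiset s_(k-1), listed with algebraic multiplicities: the Laplacian is
   real symmetric, so its characteristic polynomial splits over R. *)
Definition spectrum P k : seq R :=
  let chi := char_poly (laplacian P k) in
  flatten [seq nseq (mup x chi) x | x <- rootsR chi].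

Lemma quad_ge0 m n (A : 'M[R]_(m, n)) (v : 'rV_m) :
  0 <= (v *m (A *m A^T) *m v^T) 0 0.
Proof.
rewrite mulmxA -mulmxA -trmx_mul mxE sumr_ge0 // => i _.
by rewrite [X in _ * X]mxE -expr2 sqr_ge0.
Qed.

Lemma spectrum_ge0 P k x : x \in spectrum P k -> 0 <= x.
Proof.
move=> /flatten_mapP[y y_root]; rewrite mem_nseq => /andP[_ /eqP ->] {x}.
have : root (char_poly (laplacian P k)) y.
  move: y_root; rewrite -(roots_on_rootsR _) ?inE => [/andP[]|] //.
  by rewrite monic_neq0 // char_poly_monic.
rewrite -eigenvalue_root_char => /eigenvalueP[v vL v_neq0].
have : 0 <= (v *m laplacian P k *m v^T) 0 0.
  rewrite /laplacian mulmxDr mulmxDl mxE addr_ge0 ?quad_ge0 //.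
  case: k v {vL v_neq0 y_root} => [|k] v /=.
    by rewrite mulmx0 mul0mx mxE.
  by rewrite -{2}[boundary P k]trmxK quad_ge0.
rewrite vL -scalemxAl mxE pmulr_lge0 // mxE lt0r.
rewrite sumr_ge0 ?andbT => [|i _]; last by rewrite mxE -expr2 sqr_ge0.
apply: contra v_neq0 => /eqP sum0; apply/eqP/rowP => i; rewrite mxE.
have := psumr_eq0P _ sum0 => /(_ _ i isT) vi0.
apply/eqP; rewrite -sqrf_eq0 expr2; apply/eqP.
by rewrite -[RHS]vi0 ?mxE // => j _; rewrite mxE -expr2 sqr_ge0.
Qed.

End Laplacian.

(* ** Spectrum polynomials *)

(* Exponents of q are non-negative reals: they form a commutative monoid under
   addition, whose monoid ring over int consists of the finite formal integer
   combinations of powers of q. *)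
Record qexponent (R : rcfType) := QExponent {
  qexponent_val :> R;
  qexponent_ge0 : 0 <= qexponent_val
}.

HB.instance Definition _ (R : rcfType) := [isSub for @qexponent_val R].
HB.instance Definition _ (R : rcfType) := [Choice of qexponent R by <:].

Section QExponent.
Context {R : rcfType}.
Implicit Types x y : qexponent R.

Definition qexponent0 : qexponent R := QExponent (lexx 0).
Definition qexponent1 : qexponent R := QExponent ler01.
Definition qexponentD x y : qexponent R :=
  QExponent (addr_ge0 (qexponent_ge0 x) (qexponent_ge0 y)).

Lemma qexponentDA : associative qexponentD.
Proof. by move=> x y z; apply: val_inj; rewrite /= addrA. Qed.

Lemma qexponentDC : commutative qexponentD.
Proof. by move=> x y; apply: val_inj; rewrite /= addrC. Qed.

Lemma qexponent0D : left_id qexponent0 qexponentD.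
Proof. by move=> x; apply: val_inj; rewrite /= add0r. Qed.

Lemma qexponentD0 : right_id qexponent0 qexponentD.
Proof. by move=> x; apply: val_inj; rewrite /= addr0. Qed.

Lemma qexponentD_eq0 x y :
  qexponentD x y = qexponent0 -> x = qexponent0 /\ y = qexponent0.
Proof.
move=> /(congr1 val) /= /eqP.
rewrite paddr_eq0 ?qexponent_ge0 // => /andP[/eqP x0 /eqP y0].
by split; apply: val_inj.
Qed.

End QExponent.

HB.instance Definition _ (R : rcfType) :=
  Choice_isMonomialDef.Build (qexponent R)
    (@qexponentDA R) (@qexponent0D R) (@qexponentD0 R) (@qexponentD_eq0 R).
HB.instance Definition _ (R : rcfType) :=
  MonomialDef_isConomialDef.Build (qexponent R) (@qexponentDC R).

(* Polynomials in t = 'X over formal integer combinations of powers of q. *)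
Notation tq_poly R := {poly {malg int[qexponent R]}}.

Section SpectrumPolynomial.
Variable R : rcfType.

(* The default value of [insubd] is used only for l < 0, which does not occur
   for eigenvalues l of Laplacians, by [spectrum_ge0]. *)
Definition qpow (l : R) : {malg int[qexponent R]} :=
  << insubd qexponent0 l >>.

Definition qvar : tq_poly R := (<< qexponent1 >>)%:P.
Definition tvar : tq_poly R := 'X.

(* No face has more than #|vset (spair_big P)| elements, so that the omitted
   coefficients of higher powers of t are sums over empty spectra. *)
Definition spectrum_poly (T : finType) (P : spair T) : tq_poly R :=
  \sum_(k < #|vset (spair_big P)|.+1)
    tvar ^+ k * (\sum_(l <- spectrum P k) qpow l)%:P.

End SpectrumPolynomial.

(* ** Matroids *)

Record matroid (E : finType) := Matroid {
  indep : {set {set E}};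
  indep0 : set0 \in indep;
  indep_down : forall I J : {set E}, I \in indep -> J \subset I -> J \in indep;
  indep_aug : forall I J : {set E}, I \in indep -> J \in indep ->
    (#|I| < #|J|)%N -> exists2 x, x \in J :\: I & x |: I \in indep
}.

Section IndependenceComplex.
Context {E : finType}.

Lemma indep_sub_ground (M : matroid E) (I : {set E}) :
  I \in indep M -> I \subset [set: E].
Proof. by move=> _; apply: subsetT. Qed.

Definition IN (M : matroid E) : scomplex E :=
  SComplex (@indep_sub_ground M) (@indep_down E M).

End IndependenceComplex.

(* Main.v *)
(** Write D for the complex, B = D/e, A = D - e and N = A \ B for the cells of
    the pair, so that D = B + N + e*B, and let phi : N -> B be the part of the
    boundary of A from N to B.  The exchange axiom makes phi anticommute with
    the coboundaries; as it also anticommutes with the boundaries, it intertwines the Laplacians L_N and L_B.  It follows that L_A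
    is the direct sum of X = L_B + phi phi^* and Y = L_N + phi^* phi, and that
    L_D is the direct sum of X + 1 on B and of [[Y, phi^*], [phi, L_B + 1]] on
    N + e*B.  Two block eliminations give

      char(Y) char(L_B) = char(L_N) char(X),
      char([[Y, phi^*], [phi, L_B + 1]]) = char(L_N) char(X + 1),

    where N sits in cardinality k and B in cardinality k - 1.  Writing
    a, b, n, x, y for the resulting sums of powers of q, the recursion reads
    q x + (n + q x) = q (x + y) + q b + (1 - q) n with y + b = n + x. *)

Require Import Defs.
From mathcomp Require Import all_boot all_order all_algebra.
From mathcomp Require Import polyrcf.
From mathcomp Require Import monalg.
From mathcomp Require Import reals.

Set Implicit Arguments.
Unset Strict Implicit.
Unset Printing Implicit Defensive.

Import Order.TTheory GRing.Theory Num.Theory.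

Local Open Scope ring_scope.

(** * Characteristic polynomials under conjugation, shift and block elimination *)

Section CharPoly.
Context {R : comNzRingType}.

(** Two sizes are allowed because the matrices will be indexed by two enumerations of one set. Being
    mutually inverse, [V] and [W] force [n = m], and conjugation multiplies the determinant by det V
    det W = 1. *)
Lemma char_poly_conj n m (V : 'M[R]_(n, m)) (W : 'M[R]_(m, n)) (A : 'M[R]_m) :
  V *m W = 1%:M -> W *m V = 1%:M -> char_poly (V *m A *m W) = char_poly A.
Proof.
move=> VW WV; have eq_nm : n = m.
  by apply/eqP; rewrite eqn_leq (mulmx1_min VW) (mulmx1_min WV).
case: _ / eq_nm V W A VW WV => V W A VW WV.
rewrite /char_poly; have -> : char_poly_mx (V *m A *m W) =
    map_mx polyC V *m char_poly_mx A *m map_mx polyC W.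
  rewrite /char_poly_mx mulmxBr mulmxBl scalar_mxC.
  rewrite -[X in _ = X - _]mulmxA -!map_mxM VW map_mx1.
  by rewrite mulmx1.
rewrite !det_mulmx mulrAC -det_mulmx -map_mxM VW map_mx1 det1.
by rewrite mul1r.
Qed.

Lemma char_poly_block_diag n m (A : 'M[R]_n) (B : 'M[R]_m) :
  char_poly (block_mx A 0 0 B) = char_poly A * char_poly B.
Proof. by rewrite /char_poly char_block_diag_mx det_ublock. Qed.

(** Composition with X - 1 is a ring morphism, so it commutes with the determinant and acts
    entrywise on the characteristic matrix. *)
Lemma char_poly_addr1 n (A : 'M[R]_n) :
  char_poly (A + 1%:M) = char_poly A \Po ('X - 1%:P).
Proof.
rewrite /char_poly -det_map_mx; congr (\det _).
apply/matrixP => i j; rewrite !mxE polyCD raddfB /= comp_polyC.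
case: eqP => _; rewrite ?mulr1n ?mulr0n ?comp_polyX ?comp_poly0 ?polyC0 ?addr0
  //.
by rewrite opprD addrCA addrC.
Qed.

Variables (n m : nat) (P : 'M[R]_n) (Q : 'M[R]_m) (F : 'M[R]_(m, n)).
Hypothesis FPQ : F *m P = Q *m F.

Let charF : map_mx polyC F *m char_poly_mx P = char_poly_mx Q *m map_mx polyC F.
Proof.
by rewrite /char_poly_mx mulmxBr mulmxBl scalar_mxC -!map_mxM FPQ.
Qed.

Local Notation f := (map_mx polyC F).
Local Notation g := (map_mx polyC F^T).

(* Both sides equal det [[X - P, F^T], [F (X - P), X - Q]]. *)
Lemma char_poly_intertwine :
  char_poly (P + F^T *m F) * char_poly Q =
  char_poly P * char_poly (Q + F *m F^T).
Proof.
pose p := char_poly_mx P; pose q := char_poly_mx Q.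
have pE : char_poly_mx (P + F^T *m F) = p - g *m f.
  by rewrite /p /char_poly_mx map_mxD map_mxM opprD addrA.
have qE : char_poly_mx (Q + F *m F^T) = q - f *m g.
  by rewrite /q /char_poly_mx map_mxD map_mxM opprD addrA.
rewrite /char_poly pE qE -/p -/q.
transitivity (\det (block_mx p g (f *m p) q)).
  rewrite -(det_ublock _ g) -[LHS]mulr1.
  have <- : \det (block_mx 1%:M 0 f 1%:M) = 1 by rewrite det_lblock !det1 mulr1.
  rewrite -det_mulmx mulmx_block !mulmx0 !mulmx1 !add0r.
  by rewrite subrK [f *m p]charF.
rewrite -[LHS]mul1r.
have <- : \det (block_mx 1%:M 0 (- f) 1%:M) = 1.
  by rewrite det_lblock !det1 mulr1.
rewrite -det_mulmx mulmx_block !mul1mx !mul0mx !addr0 !mulNmx addNr.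
by rewrite det_ublock addrC.
Qed.

(** A column operation with - F turns the characteristic matrix into [[X - P, - F^T],
    [- F (X - P), X - Q - 1]], using F P = Q F. A row operation with F then clears the lower left
    corner and leaves X - Q - 1 - F F^T in the lower right one. *)
Lemma char_poly_intertwine_block :
  char_poly (block_mx (P + F^T *m F) F^T F (Q + 1%:M)) =
  char_poly P * char_poly (Q + F *m F^T + 1%:M).
Proof.
pose p := char_poly_mx P; pose q := char_poly_mx Q.
have bE : char_poly_mx (block_mx (P + F^T *m F) F^T F (Q + 1%:M)) =
   block_mx (p - g *m f) (- g) (- f) (q - 1%:M).
  rewrite /char_poly_mx map_block_mx (scalar_mx_block _ _ 'X) opp_block_mx.
  by rewrite add_block_mx !add0r !map_mxD map_mxM map_mx1 !opprD !addrA.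
have qE : char_poly_mx (Q + F *m F^T + 1%:M) = q - 1%:M - f *m g.
  by rewrite /q /char_poly_mx !map_mxD map_mxM map_mx1 !opprD !addrA addrAC.
rewrite /char_poly bE qE -/p.
have det1f (h : 'M_(m, n)) : \det (block_mx 1%:M 0 h 1%:M) = 1 :> {poly R}.
  by rewrite det_lblock !det1 mulr1.
rewrite -(det_ublock _ (- g)) -[LHS]mulr1 -[X in _ * X = _](det1f (- f)).
rewrite -det_mulmx mulmx_block !mulmx0 !mulmx1 !add0r.
rewrite !mulmxN mulNmx opprK subrK mulmxBl mul1mx opprB addrA addNr add0r.
rewrite -[LHS]mul1r -[X in X * _ = _](det1f f) -det_mulmx mulmx_block !mul1mx
  !mul0mx !addr0 mulmxN [f *m p]charF.
by rewrite subrr addrC.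
Qed.

End CharPoly.

(** * Sums over real roots counted with multiplicity *)

Section RootSum.
Context {R : rcfType} {V : nmodType}.
Implicit Types (p q : {poly R}) (f : R -> V).

(** Turns factorizations of characteristic polynomials into additive identities; for a Laplacian and
    [f := @qpow R] it is a coefficient of the spectrum polynomial. *)
Definition root_sum p f := \sum_(x <- rootsR p) f x *+ mup x p.

Lemma mem_rootsR p x : p != 0 -> (x \in rootsR p) = root p x.
Proof. by move=> p0; rewrite -(roots_on_rootsR p0) inE. Qed.

(** Non-roots have multiplicity 0, so several polynomials can share one list. *)
Lemma root_sum_supset p f (s : seq R) :
  p != 0 -> uniq s -> (forall x, root p x -> x \in s) ->
  root_sum p f = \sum_(x <- s) f x *+ mup x p.
Proof.
move=> p0 us sub; rewrite (bigID (root p)) /= addrC big1 ?add0r; last first.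
  by move=> x /mupNroot ->.
rewrite -big_filter; apply: perm_big; apply: uniq_perm.
- exact: uniq_roots.
- exact: filter_uniq.
move=> x; rewrite mem_filter mem_rootsR //.
by apply/idP/andP => [px|[]//]; split=> //; apply: sub.
Qed.

Lemma root_sumM p q f : p != 0 -> q != 0 ->
  root_sum (p * q) f = root_sum p f + root_sum q f.
Proof.
move=> p0 q0; have pq0 : p * q != 0 by rewrite mulf_neq0.
(* The list is [rootsR (p * q)] unfolded; it contains the roots of both factors. *)
have u := uniq_roots (- cauchy_bound (p * q)) (cauchy_bound (p * q)) (p * q).
rewrite (root_sum_supset f p0 u); last first.
  by move=> x; rewrite -/(rootsR _) mem_rootsR // rootM => ->.
rewrite (root_sum_supset f q0 u); last first.
  by move=> x; rewrite -/(rootsR _) mem_rootsR // rootM orbC => ->.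
rewrite -big_split; apply: eq_bigr => x _.
by rewrite mupM // mulrnDr.
Qed.

Lemma mup_comp_shift p (a x : R) : p != 0 ->
  mup x (p \Po ('X - a%:P)) = mup (x - a) p.
Proof.
move=> p0; have shiftK (b : R) q : (q \Po ('X - b%:P)) \Po ('X + b%:P) = q.
  by rewrite -comp_polyA comp_polyB comp_polyX comp_polyC addrK comp_polyXr.
have shift_neq0 (b : R) q : q != 0 -> q \Po ('X - b%:P) != 0.
  by apply: contra_neq => q0; rewrite -(shiftK b q) q0 comp_poly0.
(* A shift does not lower multiplicities; the reverse inequality is this bound applied to the shift
   back by [- a]. *)
have le_mup (b y : R) q : q != 0 -> (mup (y - b) q <= mup y (q \Po ('X -
  b%:P)))%N.
  move=> q0; rewrite mup_geq ?shift_neq0 //.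
  have := leqnn (mup (y - b) q); rewrite {1}mup_geq // => /dvdpP [r rE].
  rewrite {2}rE comp_polyM rmorphXn /= comp_polyB comp_polyX comp_polyC.
  by rewrite polyCB opprB addrA subrK dvdp_mull.
apply/eqP; rewrite eqn_leq le_mup // andbT.
have := le_mup (- a) (x - a) (p \Po ('X - a%:P)) (shift_neq0 _ _ p0).
by rewrite opprK subrK polyCN opprK shiftK.
Qed.

Lemma root_sum_shift p f (a : R) : p != 0 ->
  root_sum (p \Po ('X - a%:P)) f = root_sum p (fun x => f (x + a)).
Proof.
move=> p0; have q0 : p \Po ('X - a%:P) != 0.
  apply: contra_neq p0 => q0; rewrite -[p]comp_polyXr.
  have -> : 'X = ('X - a%:P) \Po ('X + a%:P).
    by rewrite comp_polyB comp_polyX comp_polyC addrK.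
  by rewrite comp_polyA q0 comp_poly0.
rewrite (@root_sum_supset _ _ [seq x + a | x <- rootsR p]) //.
- by rewrite big_map; apply: eq_bigr => x _; rewrite mup_comp_shift // addrK.
- by rewrite (map_inj_uniq (addIr a)) uniq_roots.
move=> x; rewrite -[x in _ -> x \in _](subrK a) (mem_map (addIr a)).
rewrite mem_rootsR // !rootE horner_comp !hornerE; exact.
Qed.

Lemma root_sum_spectrum (T : finType) (P : spair T) k f :
  \sum_(l <- spectrum P k) f l = root_sum (char_poly (laplacian P k)) f.
Proof.
rewrite /spectrum big_flatten big_map; apply: eq_bigr => x _.
by rewrite big_nseq iter_addr_0.
Qed.

End RootSum.

(** * Matrices given by two-variable functions on finite sets *)

Section KernelMatrix.
Context {R : comNzRingType} {X : finType}.
Implicit Types (S : {set X}) (f g : X -> X -> R).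

(** Separates the entries from the enumeration, so that one function can be restricted to several
    index sets. *)
Definition kmx S S' f : 'M[R]_(#|S|, #|S'|) :=
  \matrix_(i, j) f (enum_val i) (enum_val j).

Lemma eq_kmx S S' f g : {in S & S', f =2 g} -> kmx S S' f = kmx S S' g.
Proof. by move=> fg; apply/matrixP => i j; rewrite !mxE fg ?enum_valP. Qed.

Lemma mul_kmx S S' S'' f g :
  kmx S S' f *m kmx S' S'' g =
  kmx S S'' (fun x z => \sum_(y in S') f x y * g y z).
Proof.
apply/matrixP => i j; rewrite !mxE [RHS](big_enum_val (idx := 0)) /=.
by apply: eq_bigr => h _; rewrite !mxE.
Qed.

Lemma add_kmx S S' f g : kmx S S' f + kmx S S' g = kmx S S' (fun x y => f x y +
  g x y).
Proof. by apply/matrixP => i j; rewrite !mxE. Qed.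

Lemma tr_kmx S S' f : (kmx S S' f)^T = kmx S' S (fun x y => f y x).
Proof. by apply/matrixP => i j; rewrite !mxE. Qed.

Lemma kmx_eq0 S S' f : {in S & S', forall x y, f x y = 0} -> kmx S S' f = 0.
Proof. by move=> f0; apply/matrixP => i j; rewrite !mxE f0 ?enum_valP. Qed.

(** Changing the enumeration and rescaling the basis by factors of square 1 is a conjugation. *)
Lemma char_poly_reindex n m (u : 'I_n -> X) (v : 'I_m -> X) (s : X -> R) f :
  injective u -> injective v -> codom u =i codom v ->
  (forall x, s x * s x = 1) ->
  char_poly (\matrix_(i, j) (s (u i) * f (u i) (u j) * s (u j))) =
  char_poly (\matrix_(i, j) f (v i) (v j)).
Proof.
move=> u_inj v_inj uv ss.
have uv' i : u i \in codom v by rewrite -uv codom_f.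
have vu' j : v j \in codom u by rewrite uv codom_f.
(* The signed permutation matrix between the two enumerations; its transpose is its inverse. *)
pose V : 'M[R]_(n, m) := \matrix_(i, j) (s (u i) *+ (u i == v j)).
have VA p (B : 'M[R]_(m, p)) i j :
    (V *m B) i j = s (u i) * B (iinv (uv' i)) j.
  rewrite mxE (bigD1 (iinv (uv' i))) //= mxE f_iinv eqxx mulr1n big1 ?addr0 //.
  move=> h; rewrite mxE; case: (u _ =P _) => [uh|_]; last by rewrite mul0r.
  by case/eqP; apply: v_inj; rewrite f_iinv.
have VB p (B : 'M[R]_(n, p)) i j :
    (V^T *m B) i j = s (v i) * B (iinv (vu' i)) j.
  rewrite mxE (bigD1 (iinv (vu' i))) //= !mxE f_iinv eqxx mulr1n big1 ?addr0 //.
  move=> h; rewrite !mxE; case: (u _ =P _) => [uh|_]; last by rewrite mul0r.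
  by case/eqP; apply: u_inj; rewrite f_iinv.
rewrite -(@char_poly_conj _ _ _ V V^T).
- congr char_poly; apply/matrixP => i j.
  rewrite -[_ *m V^T]trmxK trmx_mul trmxK [RHS]mxE VA [_^T _ i]mxE VA !mxE
    !f_iinv.
  by rewrite mulrC.
- apply/matrixP => i j; rewrite VA !mxE f_iinv (inj_eq u_inj) eq_sym.
  by case: eqP => [->|_] /=; rewrite ?ss ?mulr0.
- apply/matrixP => i j; rewrite VB !mxE f_iinv (inj_eq v_inj).
  by case: eqP => [->|_] /=; rewrite ?ss ?mulr0.
Qed.

Lemma kmx_inj S S' f g : kmx S S' f = kmx S S' g -> {in S & S', f =2 g}.
Proof.
move=> /matrixP fg x y xS yS; have := fg (enum_rank_in xS x) (enum_rank_in yS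
  y).
by rewrite !mxE !enum_rankK_in.
Qed.

Lemma kmxD1 S f : kmx S S f + 1%:M = kmx S S (fun x y => f x y + (x == y)%:R).
Proof. by apply/matrixP => i j; rewrite !mxE (inj_eq enum_val_inj). Qed.

Section JointEnum.
Variables (n m : nat) (u : 'I_n -> X) (v : 'I_m -> X).

Definition joint_enum (i : 'I_(n + m)) : X :=
  match split i with inl j => u j | inr j => v j end.

Lemma joint_enum_inj : injective u -> injective v -> (forall i j, u i != v j) ->
  injective joint_enum.
Proof.
move=> u_inj v_inj uv i j; rewrite /joint_enum -[i]splitK -[j]splitK !unsplitK.
case: (split i) (split j) => i' [] j' //= E.
- by rewrite (u_inj _ _ E).
- by have := uv i' j'; rewrite E eqxx.
- by have := uv j' i'; rewrite E eqxx.
- by rewrite (v_inj _ _ E).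
Qed.

Lemma codom_joint_enum x :
  (x \in codom joint_enum) = (x \in codom u) || (x \in codom v).
Proof.
apply/codomP/orP => [[i ->]|[] /codomP[i ->]].
- by rewrite /joint_enum; case: split => j; [left|right]; apply: codom_f.
- by exists (unsplit (inl i)); rewrite /joint_enum unsplitK.
- by exists (unsplit (inr i)); rewrite /joint_enum unsplitK.
Qed.

Lemma matrix_joint_enum f :
  \matrix_(i, j) f (joint_enum i) (joint_enum j) =
  block_mx (\matrix_(i, j) f (u i) (u j)) (\matrix_(i, j) f (u i) (v j))
           (\matrix_(i, j) f (v i) (u j)) (\matrix_(i, j) f (v i) (v j)).
Proof.
apply/matrixP => i j; rewrite mxE /block_mx mxE /joint_enum.
by case: (split i) => i'; rewrite mxE; case: (split j) => j'; rewrite mxE.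
Qed.

End JointEnum.

Lemma codom_enum_val S : codom (fun i : 'I_#|S| => enum_val i) =i S.
Proof.
move=> x; apply/codomP/idP => [[i ->]|xS]; first exact: enum_valP.
by exists (enum_rank_in xS x); rewrite enum_rankK_in.
Qed.

End KernelMatrix.

(** * Boundary signs and Laplacian kernels *)

Section BoundaryCoef.
Context {R : rcfType} {T : finType}.
Implicit Types (F G H K : {set T}) (S : {set {set T}}) (x y : T).
Local Notation c := (@boundary_coef R T).

(** For [x] outside [F], the sign of [F] in the boundary of [x |: F], written as a product so that a
    new vertex of [F] contributes one factor. *)
Definition psign x F : R := \prod_(y in F) (-1) ^+ (enum_rank y < enum_rank
  x)%N.

Lemma psign_sqr x F : psign x F * psign x F = 1.
Proof. by rewrite -big_split big1 //= => y _; rewrite -expr2 sqrr_sign. Qed.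

Lemma psignU1 x y F : y \notin F ->
  psign x (y |: F) = (-1) ^+ (enum_rank y < enum_rank x)%N * psign x F.
Proof. exact: big_setU1. Qed.

(** Exactly one of [x], [y] precedes the other, so the two extra factors are opposite. *)
Lemma psignU1_anti x y F : x != y -> x \notin F -> y \notin F ->
  psign x (y |: F) * psign y F = - (psign y (x |: F) * psign x F).
Proof.
move=> xy xF yF; rewrite !psignU1 //.
have -> : (-1) ^+ (enum_rank y < enum_rank x)%N =
    - (-1) ^+ (enum_rank x < enum_rank y)%N :> R.
  case: (ltngtP (enum_rank x) (enum_rank y)); rewrite ?expr0 ?expr1 ?opprK //.
  by move/ord_inj/enum_rank_inj => E; rewrite E eqxx in xy.
by rewrite !mulNr mulrAC.
Qed.

Lemma boundary_coefU1 x F : x \notin F -> c F (x |: F) = psign x F.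
Proof.
move=> xF; rewrite /boundary_coef (big_pred1 x) => [|y]; last first.
  rewrite !inE; apply/andP/eqP => [[/orP[/eqP //|yF] /eqP E]|->].
    by move: xF; rewrite -E !inE eqxx andbT negbK => /eqP.
  by rewrite eqxx setU1K.
rewrite -prodr_const /psign big_mkcond [RHS]big_mkcond; apply: eq_bigr => y _.
rewrite !inE; case: eqP => [->|_] /=; first by rewrite ltnn (negPf xF).
by case: (y \in F) => //=; case: (_ < _)%N.
Qed.

Lemma boundary_coef_neq0 F G : c F G != 0 -> exists2 x, x \notin F & G = x |: F.
Proof.
move=> nz; have [x /andP[xG /eqP <-]|none] := pickP (fun x =>
  (x \in G) && (G :\ x == F)).
  by exists x; rewrite ?setD11 ?setD1K.
by move: nz; rewrite /boundary_coef big_pred0 ?eqxx.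
Qed.

Lemma boundary_coef_card F G : c F G != 0 -> #|G| = #|F|.+1.
Proof. by case/boundary_coef_neq0 => x xF ->; rewrite cardsU1 xF. Qed.

Lemma boundary_coef_sqr x F : x \notin F -> c F (x |: F) * c F (x |: F) = 1.
Proof. by move=> xF; rewrite boundary_coefU1 // psign_sqr. Qed.

(** The two chains from [F] to [y |: (x |: F)] carry opposite signs: the local form of the boundary
    squaring to zero. *)
Lemma boundary_coef_square x y F : x != y -> x \notin F -> y \notin F ->
  c F (x |: F) * c (x |: F) (y |: (x |: F)) =
  - (c F (y |: F) * c (y |: F) (x |: (y |: F))).
Proof.
move=> xy xF yF; rewrite !boundary_coefU1 ?in_setU1 ?negb_or 1?eq_sym ?xy //.
  by rewrite mulrC [in RHS]mulrC psignU1_anti 1?eq_sym.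
by rewrite eq_sym xy.
Qed.

(** Follows from the previous relation on multiplying by [c F (x |: F)] and
    [c (y |: F) (x |: (y |: F))], whose squares are 1. *)
Lemma boundary_coef_square' x y F : x != y -> x \notin F -> y \notin F ->
  c (x |: F) (y |: (x |: F)) * c (y |: F) (y |: (x |: F)) =
  - (c F (x |: F) * c F (y |: F)).
Proof.
move=> xy xF yF; have := boundary_coef_square xy xF yF.
have E : y |: (x |: F) = x |: (y |: F) by rewrite setUCA.
move=> /(congr1 (fun z => c F (x |: F) * z * c (y |: F) (x |: (y |: F)))).
rewrite mulrA boundary_coef_sqr // mul1r E => ->.
rewrite mulrN mulNr -!mulrA boundary_coef_sqr ?mulr1 //.
by rewrite in_setU1 negb_or xy.
Qed.

(** A nonzero term exhibits [G] as [F] with two vertices added. Only two sets then contribute; both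
    lie in [S] and their terms cancel. *)
Lemma boundary_boundary S F G :
  (forall H, F \subset H -> H \subset G -> H \in S) ->
  \sum_(H in S) c F H * c H G = 0.
Proof.
move=> SFG.
have [H0 /andP[_ nz]|none] := pickP (fun H =>
  (H \in S) && (c F H * c H G != 0)); last first.
  by apply: big1 => H HS; have /negbT := none H; rewrite HS negbK => /eqP.
move: nz; rewrite mulf_eq0 negb_or => /andP[nz1 nz2].
have [x xF H0E] := boundary_coef_neq0 nz1; have [y] := boundary_coef_neq0 nz2.
rewrite {H0 nz1 nz2}H0E in_setU1 negb_or => /andP[yx yF] GE.
have xF_neq : x |: F != y |: F.
  by apply/eqP => /setP/(_ y); rewrite !inE eqxx (negPf yF) (negPf yx).
have xS : x |: F \in S by apply: SFG; rewrite ?GE ?subsetUr.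
have yS : y |: F \in S by apply: SFG;
  rewrite ?GE ?subsetUr // setUS // subsetUr.
have yS' : (y |: F \in S) && (y |: F != x |: F) by rewrite yS eq_sym.
rewrite (bigD1 (x |: F)) // (bigD1 (y |: F)) //=.
rewrite big1 ?addr0 => [|H /andP[/andP[HS Hx] Hy]].
  by rewrite GE boundary_coef_square 1?eq_sym // setUCA addNr.
apply/eqP; apply: contraT; rewrite mulf_eq0 negb_or => /andP[].
case/boundary_coef_neq0 => z zF HE /boundary_coef_neq0[w _] GE'.
have : z \in G by rewrite GE' HE !inE eqxx orbT.
rewrite GE !inE (negPf zF) orbF => /orP[]/eqP zE.
  by rewrite HE zE eqxx in Hy.
by rewrite HE zE eqxx in Hx.
Qed.

(* No grading is needed: c F H = 0 unless H has one element more than F. *)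
Definition up_kernel S F G := \sum_(H in S) c F H * c G H.
Definition down_kernel S F G := \sum_(H in S) c H F * c H G.
Definition laplace_kernel S F G := up_kernel S F G + down_kernel S F G.

Lemma up_kernelU S S' F G : [disjoint S & S'] ->
  up_kernel (S :|: S') F G = up_kernel S F G + up_kernel S' F G.
Proof.
by move=> dS; rewrite -bigU //; apply: eq_bigl => H; rewrite !inE.
Qed.

Lemma down_kernelU S S' F G : [disjoint S & S'] ->
  down_kernel (S :|: S') F G = down_kernel S F G + down_kernel S' F G.
Proof.
by move=> dS; rewrite -bigU //; apply: eq_bigl => H; rewrite !inE.
Qed.

Lemma up_kernelC S F G : up_kernel S F G = up_kernel S G F.
Proof. by apply: eq_bigr => H _; rewrite mulrC. Qed.

Lemma down_kernelC S F G : down_kernel S F G = down_kernel S G F.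
Proof. by apply: eq_bigr => H _; rewrite mulrC. Qed.

Lemma laplace_kernelC S F G : laplace_kernel S F G = laplace_kernel S G F.
Proof. by rewrite /laplace_kernel up_kernelC down_kernelC. Qed.

Lemma up_kernel_eq0 S F G :
  (forall x y, x \notin F -> y \notin G -> x |: F = y |: G ->
    x |: F \notin S) ->
  up_kernel S F G = 0.
Proof.
move=> none; apply: big1 => H HS; apply/eqP; apply: contraT.
rewrite mulf_eq0 negb_or => /andP[/boundary_coef_neq0[x xF HE]].
case/boundary_coef_neq0 => y yG HE'; have := none x y xF yG.
by rewrite -HE -HE' HS => /(_ erefl).
Qed.

Lemma down_kernel_eq0 S F G :
  (forall x y H, x \notin H -> y \notin H -> F = x |: H -> G = y |: H ->
    H \notin S) ->
  down_kernel S F G = 0.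
Proof.
move=> none; apply: big1 => H HS; apply/eqP; apply: contraT.
rewrite mulf_eq0 negb_or => /andP[/boundary_coef_neq0[x xH FE]].
by case/boundary_coef_neq0 => y yH GE; have := none x y H xH yH FE GE;
  rewrite HS.
Qed.

(* Off the diagonal the only contributions come from F :|: G above and from
   F :&: G below, and they cancel. *)
Lemma laplace_kernel_eq0 S F G : F != G ->
  (forall x y K, x \notin K -> y \notin K -> F = x |: K -> G = y |: K ->
    (y |: (x |: K) \in S) = (K \in S)) ->
  laplace_kernel S F G = 0.
Proof.
move=> FG SS.
have [/existsP[x /existsP[y /existsP[K /and4P[xK yK /eqP FE /eqP GE]]]]|none] :=
  boolP [exists x, exists y, exists K : {set T},
    [&& x \notin K, y \notin K, F == x |: K & G == y |: K]]; last first.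
  rewrite /laplace_kernel up_kernel_eq0 ?down_kernel_eq0 ?addr0 //.
    move=> x y H xH yH FE GE; case/existsP: none.
    by exists x; apply/existsP; exists y; apply/existsP; exists H;
      rewrite xH yH FE GE !eqxx.
  (* A common cover yields a common facet: if [x |: F = y |: G], take [F :\ y]. *)
  move=> x y xF yG E; case/existsP: none; exists y; apply/existsP; exists x.
  apply/existsP; exists (F :\ y).
  have xy : x != y.
    apply: contraNneq FG => xy; rewrite -(setU1K xF) -(setU1K yG) E xy.
    by rewrite eqxx.
  have yF : y \in F by have := setU11 y G; rewrite -E !inE eq_sym (negPf xy).
  rewrite setD1K // setD11 !inE (negPf xF) andbF eqxx /=.
  apply/eqP/setP => z; move/setP: E => /(_ z); rewrite !inE.
  by case: (z =P y) => [-> _|_ /= <-//]; rewrite eq_sym (negPf xy) (negPf yG).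
have xy : x != y by apply: contraNneq FG => xy; rewrite FE GE xy.
(* [y |: (x |: K)] is the only common cover of [F] and [G]. *)
have FGU (z w : T) : z \notin F -> w \notin G -> z |: F = w |: G ->
    z |: F = y |: (x |: K).
  move=> zF wG E; suff -> : z = y by rewrite FE.
  have := setU11 y K; rewrite -GE => /(setU1r w); rewrite -E !inE FE !inE.
  by rewrite (negPf yK) orbF [y == x]eq_sym (negPf xy) orbF => /eqP.
(* Dually, [K] is the only common facet of [F] and [G]. *)
have FGI (z w : T) (H : {set T}) : z \notin H -> w \notin H ->
    F = z |: H -> G = w |: H -> H = K.
  move=> zH wH FE' GE'; have zx : z = x.
    have : x \in z |: H by rewrite -FE' FE setU11.
    rewrite !inE => /orP[/eqP//|xH]; have :
      x \in y |: K by rewrite -GE GE' !inE xH orbT.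
    by rewrite !inE (negPf xy) (negPf xK).
  by rewrite -(setU1K zH) -FE' FE zx setU1K.
have xyK : y \notin x |: K by rewrite !inE negb_or eq_sym xy.
have := SS _ _ _ xK yK FE GE.
case: (boolP (K \in S)) => KS /= US; last first.
  rewrite /laplace_kernel up_kernel_eq0 ?down_kernel_eq0 ?addr0 //.
    by move=> z w H zH wH FE' GE'; rewrite (FGI z w H).
  by move=> z w zF wG E; rewrite (FGU z w) // US.
rewrite /laplace_kernel /up_kernel (bigD1 (y |: (x |: K))) // big1 /= =>
  [|H /andP[HS Hn]].
  rewrite /down_kernel (bigD1 K) // big1 /= => [|H /andP[HS Hn]].
    by rewrite !addr0 FE GE boundary_coef_square' // addNr.
  apply/eqP; apply: contraT; rewrite mulf_eq0 negb_or => /andP[].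
  case/boundary_coef_neq0=> z zH FE' /boundary_coef_neq0[w wH GE'].
  by rewrite (FGI z w H) ?eqxx in Hn.
apply/eqP; apply: contraT; rewrite mulf_eq0 negb_or => /andP[].
case/boundary_coef_neq0=> z zF HE /boundary_coef_neq0[w wG HE'].
by rewrite HE (FGU z w) -?HE -?HE' ?eqxx in Hn.
Qed.

End BoundaryCoef.

(** * Graded Laplacians as restrictions of ungraded kernels *)

Section LaplaceKernel.
Context {R : rcfType} {T : finType}.
Implicit Types (F G H : {set T}) (S : {set {set T}}).
Local Notation c := (@boundary_coef R T).

(** Used to pass between sums over all cells and over one cardinality, since the dropped cells have
    coefficient 0. *)
Lemma up_kernel_sub S S' F G : S' \subset S ->
  (forall H, H \in S -> c F H != 0 -> H \in S') ->
  up_kernel S' F G = up_kernel S F G :> R.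
Proof.
move=> sub SS'; rewrite [RHS](big_setID S') /= (setIidPr sub) [X in _ +
  X]big1 ?addr0 //.
move=> H; rewrite inE => /andP[HS' HS].
by case: (eqVneq (c F H) 0) => [->|/(SS' H HS)]; rewrite ?mul0r // (negPf HS').
Qed.

Lemma down_kernel_sub S S' F G : S' \subset S ->
  (forall H, H \in S -> c H F != 0 -> H \in S') ->
  down_kernel S' F G = down_kernel S F G :> R.
Proof.
move=> sub SS'; rewrite [RHS](big_setID S') /= (setIidPr sub) [X in _ +
  X]big1 ?addr0 //.
move=> H; rewrite inE => /andP[HS' HS].
by case: (eqVneq (c H F) 0) => [->|/(SS' H HS)]; rewrite ?mul0r // (negPf HS').
Qed.

Lemma laplacian_kmx (P : spair T) k :
  laplacian P k = kmx (cells P k) (cells P k)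
    (laplace_kernel (faces (spair_big P) :\: faces (spair_small P))) :> 'M[R]__.
Proof.
have bE j : boundary P j = kmx (cells P j) (cells P j.+1) c :> 'M[R]__.
  by apply/matrixP => i i'; rewrite !mxE.
have cE j F : (F \in cells P j) =
  (F \in faces (spair_big P) :\: faces (spair_small P)) && (#|F| == j) by
    rewrite inE.
have sub j : cells P j \subset faces (spair_big P) :\: faces (spair_small P).
  by apply/subsetP => F; rewrite cE => /andP[].
have upE : boundary P k *m (boundary P k)^T =
   kmx _ _ (up_kernel (faces (spair_big P) :\: faces (spair_small P))) :>
     'M[R]__.
  rewrite bE tr_kmx mul_kmx; apply: eq_kmx => F G; rewrite cE =>
    /andP[_ /eqP Fk] _.
  apply: up_kernel_sub => // H HS /boundary_coef_card HF.
  by rewrite cE HS HF Fk /=.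
(* For k = 0 [down_laplacian] is 0 by definition, and the down kernel vanishes too, since nothing
   lies below the empty set. *)
rewrite /laplacian upE; case: k {upE} => [|k] /=.
  rewrite addr0; apply: eq_kmx => F G; rewrite cE => /andP[_ /eqP F0] _.
  rewrite /laplace_kernel [down_kernel _ _ _]big1 ?addr0 // => H _.
  case: (eqVneq (c H F) 0) => [->|/boundary_coef_card]; rewrite ?mul0r //.
  by rewrite F0.
have -> : (boundary P k)^T *m boundary P k =
   kmx _ _ (down_kernel (faces (spair_big P) :\: faces (spair_small P))) :>
     'M[R]__.
  rewrite bE tr_kmx mul_kmx; apply: eq_kmx => F G; rewrite cE =>
    /andP[_ /eqP Fk] _.
  apply: down_kernel_sub => // H HS /boundary_coef_card.
  by rewrite cE HS Fk => -[->] /=.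
by rewrite add_kmx.
Qed.

End LaplaceKernel.

(** * Laplacian entries between the pieces [B], [N] and [E] (the faces containing [e]) *)

Section DeletionContraction.
Context {R : rcfType} {T : finType}.
Variables (D : scomplex T) (e : T).
Implicit Types (F G H K : {set T}) (x y : T).
Local Notation c := (@boundary_coef R T).
Local Notation A := (deletion_faces D e).
Local Notation B := (contraction_faces D e).
Local Notation N := (A :\: B).
Local Notation E := (faces D :\: A).

Lemma mem_contraction F : (F \in B) = (e \notin F) && (e |: F \in faces D).
Proof.
apply/imsetP/andP => [[G]|[eF DF]].
  by rewrite inE => /andP[DG eG] ->; rewrite setD11 setD1K.
by exists (e |: F); rewrite ?setU1K // inE DF setU11.
Qed.

Lemma mem_deletion F : (F \in A) = (e \notin F) && (F \in faces D).
Proof. by rewrite inE andbC. Qed.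

Lemma mem_star F : (F \in E) = (e \in F) && (F \in faces D).
Proof. by rewrite inE mem_deletion; case: (F \in faces D);
  rewrite ?andbF // !andbT negbK. Qed.

Lemma contraction_sub : B \subset A.
Proof.
apply/subsetP => F; rewrite mem_contraction mem_deletion => /andP[-> DF].
exact: faces_down DF (subsetUr _ _).
Qed.

Lemma disjoint_BN : [disjoint B & N].
Proof. by rewrite disjoints_subset; apply/subsetP => F; rewrite !inE => ->. Qed.

Lemma disjoint_AE : [disjoint A & E].
Proof. by rewrite disjoints_subset; apply/subsetP => F; rewrite !inE => ->. Qed.

Lemma deletionE : B :|: N = A.
Proof.
apply/setP => F; rewrite in_setU in_setD.
by case: (boolP (F \in B)) => //= /(subsetP contraction_sub).
Qed.

Lemma facesE : A :|: E = faces D.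
Proof.
apply/setP => F; rewrite in_setU mem_star mem_deletion.
by case: (e \in F); rewrite /= ?orbF.
Qed.

Lemma big_star (f : {set T} -> R) :
  \sum_(H in E) f H = \sum_(K in B) f (e |: K).
Proof.
have -> : E = [set e |: K | K in B].
  apply/setP => F; rewrite mem_star; apply/andP/imsetP => [[eF DF]|[K]].
    by exists (F :\ e); rewrite ?setD1K // mem_contraction setD11 setD1K.
  by rewrite mem_contraction => /andP[_ DK] ->; rewrite setU11.
rewrite big_imset // => K K'; rewrite !mem_contraction =>
  /andP[eK _] /andP[eK' _] KK.
by rewrite -(setU1K eK) KK setU1K.
Qed.

Lemma setU1_inj F G : e \notin F -> e \notin G -> e |: F = e |: G -> F = G.
Proof. by move=> eF eG FG; rewrite -(setU1K eF) FG setU1K. Qed.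

(** After rescaling by [c F (e |: F)], coning with [e] anticommutes with the boundary: this is the
    sign square on [F], [K = x |: F] and [e]. *)
Lemma boundary_coef_star F K : e \notin F -> e \notin K ->
  c (e |: F) (e |: K) = - (c F (e |: F) * c K (e |: K) * c F K) :> R.
Proof.
move=> eF eK; case: (eqVneq (c F K) 0) => [FK0|].
  rewrite FK0 mulr0 oppr0; apply/eqP; apply: contraT => /boundary_coef_neq0[x].
  rewrite !inE negb_or => /andP[xe xF] KE.
  have {}KE : K = x |: F.
    apply: setU1_inj => //; first by rewrite !inE negb_or eq_sym xe.
    by rewrite KE setUCA.
  have /eqP := boundary_coef_sqr (R := R) xF.
  by rewrite -KE FK0 mul0r eq_sym oner_eq0.
case/boundary_coef_neq0 => x xF KE; subst K.
have xe : x != e by apply: contraNneq eK => ->; rewrite setU11.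
have := boundary_coef_square (R := R) xe xF eF.
move=> /(congr1 (fun z => c F (e |: F) * z)); rewrite mulrN !mulrA.
rewrite boundary_coef_sqr // mul1r setUCA => /esym/(canRL (@opprK _)) ->.
by congr (- _); rewrite mulrAC.
Qed.

(** Since [e] is not in [F], it must be the added vertex. *)
Lemma boundary_coef_cone F K : e \notin F -> e \notin K ->
  c F (e |: K) = c K (e |: K) *+ (F == K) :> R.
Proof.
move=> eF eK; case: eqVneq => [->//|FK]; apply/eqP; apply: contraT.
case/boundary_coef_neq0 => x xF KE; have := setU11 e K.
rewrite KE !inE (negPf eF) orbF => /eqP ex; subst x.
by rewrite (setU1_inj eK eF KE) eqxx in FK.
Qed.

Section Splitting.
Variables F F' G G' : {set T}.
Hypotheses (FB : F \in B) (F'B : F' \in B) (GN : G \in N) (G'N : G' \in N).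

Let eF : e \notin F. Proof. by move: FB; rewrite mem_contraction => /andP[].
  Qed.
Let eF' : e \notin F'. Proof. by move: F'B; rewrite mem_contraction => /andP[].
  Qed.
Let DeF : e |: F \in faces D.
Proof. by move: FB; rewrite mem_contraction => /andP[]. Qed.
Let DF : F \in faces D. Proof. by apply: faces_down DeF _; apply: subsetUr. Qed.
Let GA : G \in A. Proof. by move: GN; rewrite inE => /andP[]. Qed.
Let eG : e \notin G. Proof. by move: GA; rewrite mem_deletion => /andP[]. Qed.
Let DeG : e |: G \notin faces D.
Proof. by move: GN; rewrite inE mem_contraction eG => /andP[]. Qed.

(** [B] is closed under subsets, so no cell of [N] lies below a cell of [B]. *)
Lemma laplace_deletion_BB :
  laplace_kernel A F F' = laplace_kernel B F F' + up_kernel N F F' :> R.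
Proof.
rewrite -[in LHS]deletionE /laplace_kernel up_kernelU ?down_kernelU
  ?disjoint_BN //.
rewrite [down_kernel N _ _]down_kernel_eq0 ?addr0 1?addrAC // => x y H _ _ FE _.
rewrite inE negb_and negbK; apply/orP; left.
apply: (@faces_down _ (contraction D e)) FB _.
by rewrite FE subsetUr.
Qed.

(** For the same reason, no cell of [B] lies above a cell of [N]. *)
Lemma laplace_deletion_NN :
  laplace_kernel A G G' = laplace_kernel N G G' + down_kernel B G G' :> R.
Proof.
rewrite -[in LHS]deletionE /laplace_kernel up_kernelU ?down_kernelU
  ?disjoint_BN //.
rewrite [up_kernel B _ _]up_kernel_eq0 ?add0r 1?addrCA 1?addrC // => x y _ _ _.
apply/negP => /(@faces_down _ (contraction D e))/(_ (subsetUr _ _)) GB.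
by move: GN; rewrite inE GB.
Qed.

(** The only face through [e] covering [F] is [e |: F], and it covers [F'] only if [F = F']; this
    gives the identity term. *)
Lemma laplace_faces_BB :
  laplace_kernel (faces D) F F' = laplace_kernel A F F' + (F == F')%:R :> R.
Proof.
rewrite -facesE /laplace_kernel up_kernelU ?down_kernelU ?disjoint_AE //.
rewrite [down_kernel E _ _]down_kernel_eq0 ?addr0 => [|x y H _ _ FE _];
  last first.
  by rewrite mem_star; apply: contra eF; rewrite FE !inE => /andP[-> _];
    rewrite orbT.
rewrite addrAC; congr (_ + _); rewrite /up_kernel big_star.
rewrite (bigD1 F) //= (@boundary_coef_cone F' F) //.
rewrite big1 ?addr0 => [|K /andP[KB KF]].
  by rewrite eq_sym mulrnAr boundary_coef_sqr.
move: KB; rewrite mem_contraction => /andP[eK _].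
by rewrite boundary_coef_cone // eq_sym (negPf KF) mul0r.
Qed.

Lemma laplace_faces_NN :
  laplace_kernel (faces D) G G' = laplace_kernel A G G' :> R.
Proof.
rewrite -facesE /laplace_kernel up_kernelU ?down_kernelU ?disjoint_AE //.
rewrite [down_kernel E _ _]down_kernel_eq0 => [|x y H _ _ GE _]; last first.
  by rewrite mem_star; apply: contra eG; rewrite GE !inE => /andP[-> _];
    rewrite orbT.
rewrite [up_kernel E _ _]up_kernel_eq0 ?addr0 // => x y xG _ _.
rewrite mem_star !inE (negPf eG) orbF; apply/negP => /andP[/eqP <-].
exact/negP.
Qed.

(** A common cover of the two sets would be [e |: F], a face, and a common facet would be a subset
    of [F], also a face; their contributions cancel. *)
Lemma laplace_faces_BE : laplace_kernel (faces D) F (e |: F') = 0 :> R.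
Proof.
apply: laplace_kernel_eq0 => [|x y K xK yK FE F'E].
  by apply: contraNneq eF => ->; rewrite setU11.
have ye : y = e.
  have := setU11 e F'; rewrite F'E !inE => /orP[/eqP->//|eK].
  by move: eF; rewrite FE !inE eK orbT.
rewrite ye -FE DeF; apply/esym; apply: faces_down DF _.
by rewrite FE subsetUr.
Qed.

(** A common cover would contain [e |: G], which is not a face; below, a facet of [G] avoids [e], so
    it can be a facet of [e |: F] only if it is [F]. *)
Lemma laplace_faces_NE :
  laplace_kernel (faces D) G (e |: F) = c F G * c F (e |: F) :> R.
Proof.
rewrite /laplace_kernel up_kernel_eq0 ?add0r => [|x y xG _ E]; last first.
  apply: contra DeG => DxG; apply: faces_down DxG _.
  by rewrite subUset subsetUr E andbT sub1set !inE eqxx orbT.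
rewrite /down_kernel (bigD1 F) //= big1 ?addr0 // => H /andP[DH HF].
case: (eqVneq (c H G) 0) => [->|/boundary_coef_neq0[x _ GE]];
  first by rewrite mul0r.
rewrite boundary_coef_cone // ?(negPf HF) ?mulr0n ?mulr0 //.
by apply: contra eG; rewrite GE !inE => ->; rewrite orbT.
Qed.

(** Neighbours containing [e] reproduce the kernel of [B], the two minus signs of
    [boundary_coef_star] cancelling; the facet [F] of [e |: F] adds the identity. *)
Lemma laplace_faces_EE :
  laplace_kernel (faces D) (e |: F) (e |: F') =
  c F (e |: F) * (laplace_kernel B F F' + (F == F')%:R) * c F' (e |: F') :> R.
Proof.
pose s K : R := c K (e |: K).
have sK K : e \notin K -> s K * s K = 1 by apply: boundary_coef_sqr.
have eB K : K \in B -> e \notin K by rewrite mem_contraction => /andP[].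
have upE : up_kernel (faces D) (e |: F) (e |: F') =
  s F * up_kernel B F F' * s F'.
  rewrite -facesE up_kernelU ?disjoint_AE // up_kernel_eq0 => [|x y _ _ _];
    last first.
    by rewrite mem_deletion !inE eqxx orbT.
  rewrite add0r /up_kernel big_star (mulr_sumr _ _ _ (s F)) (mulr_suml _ _ _ (s
    F')) /=.
  apply: eq_bigr => K KB; rewrite !boundary_coef_star ?eB // -!/(s _) mulrNN.
  rewrite mulrACA [s F * s K * _]mulrACA.
  by rewrite sK ?eB // mulr1 mulrAC !mulrA.
have downE : down_kernel (faces D) (e |: F) (e |: F') =
    s F * (down_kernel B F F' + (F == F')%:R) * s F'.
  rewrite -facesE down_kernelU ?disjoint_AE // addrC mulrDr mulrDl; congr (_ +
    _).
    rewrite /down_kernel big_star (mulr_sumr _ _ _ (s F)) (mulr_suml _ _ _ (s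
      F')) /=.
    apply: eq_bigr => K KB; rewrite !boundary_coef_star ?eB // -!/(s _) mulrNN.
    rewrite mulrACA [s K * s F * _]mulrACA.
    by rewrite sK ?eB // mul1r mulrAC !mulrA.
  have FA : F \in A by rewrite mem_deletion eF.
  rewrite /down_kernel (bigD1 F) //= big1 ?addr0 => [|K /andP[KA KF]].
    rewrite (@boundary_coef_cone F F') // -!/(s _).
    by case: eqVneq => [->|]; rewrite ?mulr1 ?mulr0 ?mul0r.
  have eK : e \notin K by move: KA; rewrite mem_deletion => /andP[].
  by rewrite boundary_coef_cone // (negPf KF) mul0r.
by rewrite {1}/laplace_kernel upE downE -mulrDl -mulrDr addrA.
Qed.

Hypothesis exchange : forall K x y, x != y -> x \notin K -> y \notin K ->
  x |: K \in B -> y |: K \in N -> y |: (x |: K) \in faces D.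

(** When [F] and [G] are adjacent, [exchange] makes their union a face and their intersection is one
    anyway; both avoid [e], so the two contributions cancel. *)
Lemma laplace_deletion_BN : laplace_kernel A F G = 0 :> R.
Proof.
have FG : F != G by apply: contraTneq FB => ->; move: GN; rewrite inE =>
  /andP[].
apply: laplace_kernel_eq0 => // x y K xK yK FE GE.
have xy : x != y by apply: contraNneq FG => xy; rewrite FE GE xy.
have DK : K \in faces D by apply: faces_down DF _; rewrite FE subsetUr.
have yxK : y |: (x |: K) \in faces D by apply: exchange; rewrite -?FE -?GE.
rewrite !mem_deletion DK yxK !andbT.
by rewrite (setUCA [set y]) -GE !in_setU1 GE !in_setU1; move: eF eG;
  rewrite FE GE !in_setU1 !negb_or => /andP[-> ->] /andP[->].
Qed.

Lemma laplace_faces_BN : laplace_kernel (faces D) F G = 0 :> R.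
Proof.
rewrite -facesE /laplace_kernel up_kernelU ?down_kernelU ?disjoint_AE //.
rewrite addrACA -/(laplace_kernel _ _ _) laplace_deletion_BN add0r.
rewrite up_kernel_eq0 ?down_kernel_eq0 ?addr0 // =>
  [x y H _ _ FE _|x y xF yG E].
  by rewrite mem_star; apply: contra eF; rewrite FE !inE => /andP[-> _];
    rewrite orbT.
rewrite mem_star; apply/negP => /andP[].
rewrite {1}E !inE (negPf eG) orbF => /eqP ey; rewrite E -ey; exact/negP.
Qed.

End Splitting.


Hypothesis exchange : forall K x y, x != y -> x \notin K -> y \notin K ->
  x |: K \in B -> y |: K \in N -> y |: (x |: K) \in faces D.

(** [kmx B N c] anticommutes with the boundaries and with their transposes; each summand of a
    Laplacian uses one of each, so the signs cancel. All cardinalities are treated at once. *)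
Lemma kmx_intertwine :
  kmx B N c *m kmx N N (laplace_kernel N) =
  kmx B B (laplace_kernel B) *m kmx B N c :> 'M[R]__.
Proof.
pose f : 'M[R]__ := kmx B N c; pose dB : 'M[R]__ := kmx B B c; pose dN :
  'M[R]__ := kmx N N c.
have lapE S : kmx S S (laplace_kernel S) =
    kmx S S c *m (kmx S S c)^T + (kmx S S c)^T *m kmx S S c :> 'M[R]__.
  by rewrite tr_kmx !mul_kmx add_kmx; apply: eq_kmx => x y _ _.
(* The vanishing of the squared boundary of the deletion, read between [B] and [N]. *)
have f_dN : f *m dN = - (dB *m f).
  apply/eqP; rewrite -addr_eq0 addrC !mul_kmx add_kmx; apply/eqP/kmx_eq0 =>
    F G FB GN.
  rewrite -bigU ?disjoint_BN //= -[RHS](boundary_boundary (R := R) (S := A) (F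
    := F) (G := G)).
    by apply: eq_bigl => H; rewrite -[in RHS]deletionE !in_setU.
  move=> H _ HG; move: GN; rewrite in_setD => /andP[_].
  by move/(@faces_down _ (deletion D e)); apply.
(* The vanishing of the deletion Laplacian between [B] and [N]: only the up part through [N] and the
   down part through [B] survive. *)
have f_dNt : f *m dN^T = - (dB^T *m f).
  apply/eqP; rewrite -addr_eq0 !tr_kmx !mul_kmx add_kmx; apply/eqP/kmx_eq0 =>
    F G FB GN.
  rewrite -[RHS](laplace_deletion_BN FB GN exchange) -[X in laplace_kernel
    X]deletionE /laplace_kernel.
  rewrite up_kernelU ?down_kernelU ?disjoint_BN //.
  rewrite [up_kernel B _ _]up_kernel_eq0 ?add0r => [|x y xF yG ->]; last first.
    apply: contraL GN => /(@faces_down _ (contraction D e))/(_ (subsetUr _ _))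
      GB.
    by rewrite in_setD GB.
  rewrite [down_kernel N _ _]down_kernel_eq0 ?addr0 // => x y H _ _ FE _.
  rewrite in_setD negb_and negbK; apply/orP; left.
  by apply: (@faces_down _ (contraction D e)) FB _; rewrite FE subsetUr.
rewrite !lapE mulmxDr mulmxDl !mulmxA -/f -/dB -/dN f_dN f_dNt !mulNmx.
by rewrite -!mulmxA f_dN f_dNt !mulmxN !opprK.
Qed.

End DeletionContraction.

(** * Factorizations of characteristic polynomials at a fixed cardinality *)

Section GradedLaplacians.
Context {R : rcfType} {T : finType}.
Variables (D : scomplex T) (e : T).
Implicit Types (F G H K : {set T}) (x y : T).
Local Notation c := (@boundary_coef R T).
Local Notation A := (deletion_faces D e).
Local Notation B := (contraction_faces D e).
Local Notation N := (A :\: B).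
Local Notation E := (faces D :\: A).

Hypothesis exchange : forall K x y, x != y -> x \notin K -> y \notin K ->
  x |: K \in B -> y |: K \in N -> y |: (x |: K) \in faces D.

Variable k : nat.

Definition level (S : {set {set T}}) := [set F in S | #|F| == k].
(* Empty for k = 0, so that the bottom dimension needs no separate treatment. *)
Definition level_pred (S : {set {set T}}) := [set F in S | #|F|.+1 == k].

Local Notation kB := (laplace_kernel (R := R) B).
Local Notation kN := (laplace_kernel (R := R) N).
Local Notation uN := (up_kernel (R := R) N).
Local Notation dB := (down_kernel (R := R) B).

Let in_level S F : (F \in level S) = (F \in S) && (#|F| == k).
Proof. by rewrite inE. Qed.
Let in_level_pred S F : (F \in level_pred S) = (F \in S) && (#|F|.+1 == k).
Proof. by rewrite inE. Qed.

Let subB F : F \in level B -> F \in B. Proof. by rewrite inE => /andP[]. Qed.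
Let subB' F : F \in level_pred B -> F \in B. Proof. by rewrite inE => /andP[].
  Qed.
Let subN F : F \in level N -> F \in N. Proof. by rewrite inE => /andP[]. Qed.

Let BN_neq F G : F \in B -> G \in N -> F != G.
Proof. by move=> FB; apply: contraTneq => <-; rewrite in_setD FB. Qed.

Let eB F : F \in B -> e \notin F.
Proof. by rewrite mem_contraction => /andP[]. Qed.

Lemma char_poly_deletion :
  char_poly (kmx (level A) (level A) (laplace_kernel A)) =
  char_poly (kmx (level B) (level B) (fun F G => kB F G + uN F G)) *
  char_poly (kmx (level N) (level N) (fun F G => kN F G + dB F G)).
Proof.
pose u := joint_enum (fun i : 'I_#|level B| => enum_val i)
  (fun i : 'I_#|level N| => enum_val i).
rewrite -(char_poly_reindex (u := u) (s := fun=> 1)); first last.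
- by move=> x; apply: mulr1.
- move=> F; rewrite codom_joint_enum !codom_enum_val !in_level.
  by rewrite -andb_orl -[in RHS]deletionE !in_setU.
- exact: enum_val_inj.
- apply: joint_enum_inj; try exact: enum_val_inj.
  move=> i j; apply: BN_neq; [apply: subB|apply: subN]; exact: enum_valP.
rewrite (matrix_joint_enum _ _ (fun F G : {set T} =>
  1 * laplace_kernel (R := R) A F G * 1)) -char_poly_block_diag.
congr char_poly; congr block_mx; apply/matrixP => i j; rewrite !mxE mul1r mulr1.
- by apply: laplace_deletion_BB; apply: subB; apply: enum_valP.
- exact: laplace_deletion_BN (subB (enum_valP i)) (subN (enum_valP j)) exchange.
- rewrite laplace_kernelC.
  exact: laplace_deletion_BN (subB (enum_valP j)) (subN (enum_valP i)) exchange.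
- by apply: laplace_deletion_NN; apply: subN; apply: enum_valP.
Qed.

Let P := kmx (level N) (level N) kN.
Let Q := kmx (level_pred B) (level_pred B) kB.
Let Phi := kmx (level_pred B) (level N) c.

Let Phi_PQ : Phi *m P = Q *m Phi.
Proof.
rewrite !mul_kmx; apply: eq_kmx => F G FB GN.
have := kmx_intertwine (R := R) exchange; rewrite !mul_kmx => /kmx_inj.
move=> /(_ F G (subB' FB) (subN GN)).
(* A nonzero boundary coefficient fixes the cardinality of the intermediate cell, so the ungraded
   sums shrink to one level. *)
have -> : \sum_(y in N) c F y * kN y G = \sum_(y in level N) c F y * kN y G.
  rewrite [LHS](bigID (fun H => #|H| == k)) /= addrC big1 ?add0r.
    by apply: eq_bigl => H; rewrite (in_level, in_level_pred).
  move=> H /andP[_ Hk]; case: (eqVneq (c F H) 0) => [->|/boundary_coef_card HF].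
    by rewrite mul0r.
  by move: FB Hk; rewrite in_level_pred HF => /andP[_ ->].
move=> ->; rewrite [LHS](bigID (fun H => #|H|.+1 == k)) /= addrC big1 ?add0r.
  by apply: eq_bigl => H; rewrite (in_level, in_level_pred).
move=> H /andP[_ Hk]; case: (eqVneq (c H G) 0) => [->|/boundary_coef_card GH].
  by rewrite mulr0.
by move: GN Hk; rewrite in_level GH => /andP[_ ->].
Qed.

Let PhiE : P + Phi^T *m Phi =
  kmx (level N) (level N) (fun F G => kN F G + dB F G).
Proof.
rewrite tr_kmx mul_kmx add_kmx; apply: eq_kmx => F G;
  rewrite (in_level, in_level_pred) => /andP[_ /eqP Fk] _.
congr (_ + _); apply: down_kernel_sub => [|H HB /boundary_coef_card FH].
  by apply/subsetP => H /subB'.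
by rewrite in_level_pred HB -FH Fk eqxx.
Qed.

Let PhiE' : Q + Phi *m Phi^T =
  kmx (level_pred B) (level_pred B) (fun F G => kB F G + uN F G).
Proof.
rewrite tr_kmx mul_kmx add_kmx; apply: eq_kmx => F G;
  rewrite (in_level, in_level_pred) => /andP[_ /eqP Fk] _.
congr (_ + _); apply: up_kernel_sub => [|H HN /boundary_coef_card FH].
  by apply/subsetP => H /subN.
by rewrite in_level HN FH Fk eqxx.
Qed.

Lemma char_poly_exchange :
  char_poly (kmx (level N) (level N) (fun F G => kN F G + dB F G)) *
  char_poly Q =
  char_poly P *
  char_poly (kmx (level_pred B) (level_pred B) (fun F G => kB F G + uN F G)).
Proof. by rewrite -PhiE char_poly_intertwine // PhiE'. Qed.

(** The first factor comes from [B], which decouples from the other cells; the other two come from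
    the block on [N] and the cones over [B], by [char_poly_intertwine_block]. *)
Lemma char_poly_faces :
  char_poly (kmx (level (faces D)) (level (faces D))
    (laplace_kernel (faces D))) =
  char_poly (kmx (level B) (level B) (fun F G => kB F G + uN F G) + 1%:M) *
  (char_poly P *
   char_poly (kmx (level_pred B) (level_pred B)
     (fun F G => kB F G + uN F G) + 1%:M)).
Proof.
(* Scaling the cell e |: F by the coefficient of F in its boundary makes
   F |-> e |: F anticommute with the boundary. *)
pose s F := if e \in F then c (F :\ e) F else 1.
have ss F : s F * s F = 1.
  rewrite /s; case: ifP => [eF|_]; last by rewrite mulr1.
  by rewrite -{2 4}(setD1K eF) boundary_coef_sqr ?setD11.
have sB F : F \in A -> s F = 1 by rewrite /s mem_deletion => /andP[/negPf->].
have sE F : F \in B -> s (e |: F) = c F (e |: F).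
  by move/eB => eF; rewrite /s setU11 setU1K.
pose uE := fun i : 'I_#|level_pred B| => e |: enum_val i.
have uE_inj : injective uE.
  move=> i j; rewrite /uE => /setU1_inj E; apply: enum_val_inj; apply: E;
  by apply: eB; apply: subB'; apply: enum_valP.
(* Cells are listed in the order [B], [N], cones [e |: F] with [F] in [level_pred B]; the nesting
   matches the nested block matrices. *)
pose u := joint_enum (fun i : 'I_#|level B| => enum_val i)
  (joint_enum (fun i : 'I_#|level N| => enum_val i) uE).
have AE_neq F i : e \notin F -> F != uE i.
  by apply: contraNneq => ->; rewrite setU11.
have eN F : F \in N -> e \notin F by rewrite in_setD mem_deletion => /and3P[].
rewrite -(char_poly_reindex (u := u) (s := s)) //; first last.
- move=> F; rewrite !codom_joint_enum !codom_enum_val orbA.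
  have -> : (F \in codom uE) = (F \in E) && (#|F| == k).
    apply/codomP/andP => [[i ->]|[]].
      have := enum_valP i; rewrite in_level_pred => /andP[FB Fk].
      move: (FB); rewrite mem_star setU11 mem_contraction => /andP[eF ->].
      by split=> //; rewrite /uE cardsU1 eF.
    rewrite mem_star => /andP[eF DF] Fk; have FB : F :\ e \in level_pred B.
      rewrite in_level_pred mem_contraction setD11 setD1K // DF -(eqP Fk).
      by rewrite [in X in _ == X](cardsD1 e F) eF add1n eqxx.
    by exists (enum_rank_in FB (F :\ e)); rewrite /uE enum_rankK_in // setD1K.
  by rewrite !in_level -!andb_orl -!in_setU deletionE facesE.
- exact: enum_val_inj.
- apply: joint_enum_inj; first exact: enum_val_inj.
    apply: joint_enum_inj => //; first exact: enum_val_inj.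
    by move=> i j; apply/AE_neq/eN/subN/enum_valP.
  move=> i j; apply: contraTneq (codom_f (joint_enum (fun i : 'I_#|level N| =>
    enum_val i) uE) j).
  move=> <-; rewrite codom_joint_enum codom_enum_val negb_or; apply/andP; split.
    by apply/negP => /subN; rewrite in_setD (subB (enum_valP i)).
  by apply/codomP => -[h] /eqP; apply/negP/AE_neq/eB/subB/enum_valP.
rewrite !(matrix_joint_enum _ _ (fun F G : {set T} =>
  s F * laplace_kernel (faces D) F G * s G)).
rewrite -PhiE' -(char_poly_intertwine_block Phi_PQ) -char_poly_block_diag PhiE
  !kmxD1.
have A_B F : F \in B -> F \in A := subsetP (contraction_sub D e) F.
have A_N F : F \in N -> F \in A by rewrite in_setD => /andP[].
have BN0 F G : F \in B -> G \in N -> laplace_kernel (faces D) F G = 0 :> R.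
  by move=> FB GN; apply: laplace_faces_BN FB GN exchange.
have BE0 F i : F \in B -> laplace_kernel (faces D) F (uE i) = 0 :> R.
  by move=> FB; apply: laplace_faces_BE FB.
have Brest0 F i : F \in B ->
    laplace_kernel (faces D) F (joint_enum (fun i : 'I_#|level N| =>
      enum_val i) uE i) = 0 :> R.
  move=> FB; rewrite /joint_enum; case: split => j; last exact: BE0.
  by apply: BN0 => //; apply/subN/enum_valP.
congr char_poly; congr block_mx.
- apply/matrixP => i j; rewrite !mxE; have FB := subB (enum_valP i).
  have F'B := subB (enum_valP j).
  by rewrite (laplace_faces_BB FB F'B) laplace_deletion_BB // !sB ?A_B // mul1r
    mulr1.
- apply/matrixP => i j; rewrite !mxE Brest0 ?mulr0 ?mul0r //.
  exact/subB/enum_valP.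
- apply/matrixP => i j; rewrite !mxE laplace_kernelC Brest0 ?mulr0 ?mul0r //.
  exact/subB/enum_valP.
congr block_mx; apply/matrixP => i j; rewrite !mxE.
- have GN := subN (enum_valP i); have G'N := subN (enum_valP j).
  by rewrite (laplace_faces_NN _ GN) laplace_deletion_NN // !sB ?A_N // mul1r
    mulr1.
(* The scaling factor of the cone cancels the sign in [laplace_faces_NE], leaving the entry of
   [Phi^T]. *)
- have GN := subN (enum_valP i); have FB := subB' (enum_valP j).
  rewrite (laplace_faces_NE FB GN) sB ?A_N // sE // mul1r -mulrA.
  by rewrite boundary_coef_sqr ?mulr1 ?eB.
- have GN := subN (enum_valP j); have FB := subB' (enum_valP i).
  rewrite laplace_kernelC (laplace_faces_NE FB GN) (sB (enum_val j)) ?A_N // sE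
    //.
  by rewrite mulr1 mulrCA boundary_coef_sqr ?mulr1 ?eB.
have FB := subB' (enum_valP i); have F'B := subB' (enum_valP j).
rewrite (laplace_faces_EE FB F'B) !sE // !mulrA boundary_coef_sqr ?eB // mul1r
  -mulrA.
by rewrite boundary_coef_sqr ?eB // mulr1.
Qed.

End GradedLaplacians.

(** * From characteristic polynomials to sums of powers of q *)

Section SpectrumSums.
Context {R : rcfType} {T : finType}.
Implicit Types (P : spair T) (S : {set {set T}}) (f : {set T} -> {set T} -> R).

Lemma char_poly_neq0 n (A : 'M[R]_n) : char_poly A != 0.
Proof. exact/monic_neq0/char_poly_monic. Qed.

Lemma rootsR_char_poly0 f : rootsR (char_poly (kmx set0 set0 f)) = [::].
Proof.
have /eqP/size_poly1P[c _ ->] : size (char_poly (kmx set0 set0 f)) = 1%N.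
  by rewrite size_char_poly cards0.
exact: rootsRC.
Qed.

(** Nonnegativity keeps [insubd] away from its default value. *)
Lemma qpowD1 (l : R) : 0 <= l -> qpow (l + 1) = << qexponent1 >> * qpow l.
Proof.
move=> l0; have insubdE z : 0 <= z -> val (insubd (@qexponent0 R) z) = z.
  by move=> z0; rewrite val_insubd z0.
rewrite /qpow malgM_def fgmulUU mulr1; congr << _ >>; apply: val_inj.
rewrite insubdE ?addr_ge0 ?ler01 //.
transitivity (1 + val (insubd (@qexponent0 R) l)); last by [].
by rewrite insubdE // addrC.
Qed.

Lemma root_sum_qpow_shift n (A : 'M[R]_n) :
  {in rootsR (char_poly A), forall l, 0 <= l} ->
  root_sum (char_poly (A + 1%:M)) (@qpow R) =
  << qexponent1 >> * root_sum (char_poly A) (@qpow R).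
Proof.
move=> ge0; rewrite char_poly_addr1 root_sum_shift ?char_poly_neq0 //.
rewrite /root_sum big_distrr; apply: eq_big_seq => l /ge0 l0 /=.
by rewrite qpowD1 // mulrnAr.
Qed.

(** Beyond the number of vertices there are no cells, and an empty matrix has no eigenvalues. This
    allows a common summation range. *)
Lemma spectrum_poly_widen P n : (#|vset (spair_big P)| <= n)%N ->
  spectrum_poly R P =
  \sum_(k < n.+1) 'X ^+ k * (root_sum (char_poly (laplacian P k)) (@qpow R))%:P.
Proof.
move=> le_n; rewrite /spectrum_poly.
under eq_bigr do rewrite root_sum_spectrum.
rewrite -!(big_mkord xpredT (fun k => 'X ^+ k * (root_sum (char_poly (laplacian
  P k)) (@qpow R))%:P)).
rewrite [RHS](big_cat_nat _ (n := #|vset (spair_big P)|.+1)) //=.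
rewrite [X in _ = _ + X]big_nat_cond [X in _ = _ + X]big1 ?addr0 // =>
  k /andP[/andP[lt_k _] _].
rewrite laplacian_kmx; have -> : cells P k = set0.
  apply/setP => F; rewrite !inE; apply/negP =>
    /andP[/andP[_ /faces_sub/subset_leq_card]].
  by move=> + /eqP Fk; rewrite Fk leqNgt lt_k.
by rewrite /root_sum rootsR_char_poly0 big_nil polyC0 mulr0.
Qed.

End SpectrumSums.

(** * The recursion for each power of t *)

Section LevelRecursion.
Context {R : rcfType} {T : finType}.
Variables (D : scomplex T) (e : T).
Local Notation A := (deletion_faces D e).
Local Notation B := (contraction_faces D e).
Local Notation N := (A :\: B).

Hypothesis exchange : forall (K : {set T}) x y, x != y -> x \notin K -> y
  \notin K ->
  x |: K \in B -> y |: K \in N -> y |: (x |: K) \in faces D.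

Local Notation X S := (kmx S S (fun F G => laplace_kernel (R := R) B F G +
  up_kernel N F G)).
Local Notation qsum M := (root_sum (char_poly M) (@qpow R)).
Local Notation q := (<< qexponent1 >> : {malg int[qexponent R]}).

(** By [char_poly_deletion] these roots are eigenvalues of the Laplacian of the deletion. *)
Lemma spectral_ge0 k :
  {in rootsR (char_poly (X (level k B))), forall l, 0 <= l}.
Proof.
move=> l; rewrite mem_rootsR ?char_poly_neq0 // => rl.
apply: (@spectrum_ge0 _ _ (deletion D e) k).
have : l \in rootsR (char_poly (laplacian (deletion D e) k)).
  rewrite mem_rootsR ?char_poly_neq0 // laplacian_kmx /cells setD0 /=.
  by rewrite (char_poly_deletion exchange) rootM rl.
move=> lr; apply/flatten_mapP; exists l => //; rewrite mem_nseq eqxx andbT.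
rewrite -XsubC_dvd ?char_poly_neq0 //; move: lr.
by rewrite mem_rootsR ?char_poly_neq0 // dvdp_XsubCl.
Qed.

Lemma level_predS k (S : {set {set T}}) : level_pred k.+1 S = level k S.
Proof. by apply/setP => F; rewrite !inE eqSS. Qed.

Lemma level_pred0 (S : {set {set T}}) : level_pred 0 S = set0.
Proof. by apply/setP => F; rewrite !inE andbF. Qed.

Lemma level_recursion k :
  qsum (kmx (level k (faces D)) (level k (faces D))
    (laplace_kernel (faces D))) =
  q * qsum (kmx (level k A) (level k A) (laplace_kernel A)) +
  q * qsum (kmx (level_pred k B) (level_pred k B) (laplace_kernel B)) +
  (1 - q) * qsum (kmx (level k N) (level k N) (laplace_kernel N)).
Proof.
have ge0 : {in rootsR (char_poly (X (level_pred k B))), forall l, 0 <= l}.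
  case: k => [|k]; last by rewrite level_predS; apply: spectral_ge0.
  by rewrite level_pred0 rootsR_char_poly0.
rewrite (char_poly_faces exchange) (char_poly_deletion exchange).
rewrite (root_sumM _ (char_poly_neq0 _) (mulf_neq0 (char_poly_neq0 _)
  (char_poly_neq0 _))).
rewrite !(root_sumM _ (char_poly_neq0 _) (char_poly_neq0 _)).
rewrite (root_sum_qpow_shift (@spectral_ge0 k)) (root_sum_qpow_shift ge0).
have /(congr1 (root_sum^~ (@qpow R))) := char_poly_exchange (R := R) exchange k.
rewrite !(root_sumM _ (char_poly_neq0 _) (char_poly_neq0 _)).
move: (root_sum _ _) (root_sum _ _) (root_sum _ _) (root_sum _ _) (root_sum _
  _).
move=> x x' n y b ex.
(* The level-[k] terms of [X] cancel; the rest is q times the relation [ex]. *)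
rewrite mulrDr -!addrA; congr (_ + _).
by rewrite addrA -mulrDr ex mulrDr mulrBl mul1r addrC addrA subrK.
Qed.

End LevelRecursion.

(** * Assembly of the spectrum polynomials and the matroid case *)

Lemma poly_sum_recursion (A : comNzRingType) (q : A) n (d a b b' c : nat -> A) :
  b' 0%N = 0 -> (forall k, b' k.+1 = b k) ->
  (forall k, d k = q * a k + q * b' k + (1 - q) * c k) ->
  \sum_(k < n.+1) 'X ^+ k * (d k)%:P =
    q%:P * (\sum_(k < n.+1) 'X ^+ k * (a k)%:P)
    + q%:P * 'X * (\sum_(k < n) 'X ^+ k * (b k)%:P)
    + (1 - q%:P) * (\sum_(k < n.+1) 'X ^+ k * (c k)%:P).
Proof.
move=> b'0 b'S dE.
(* The factor t shifts the contraction by one cardinality, so its sum needs one term fewer. *)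
have -> : q%:P * 'X * (\sum_(k < n) 'X ^+ k * (b k)%:P) =
    q%:P * (\sum_(k < n.+1) 'X ^+ k * (b' k)%:P).
  rewrite [in RHS]big_ord_recl b'0 polyC0 mulr0 add0r -mulrA mulr_sumr.
  by congr (_ * _); apply: eq_bigr => k _; rewrite lift0 b'S mulrA -exprS.
rewrite !mulr_sumr -!big_split; apply: eq_bigr => k _ /=.
rewrite dE !polyCD !polyCM polyCB polyC1 !mulrDr.
by congr (_ + _ + _); rewrite mulrCA.
Qed.

(** Augment [y |: K] from the larger independent set [e |: (x |: K)]. The new element cannot be [e],
    as [e |: (y |: K)] is dependent, so it is [x]. *)
Lemma matroid_exchange (E : finType) (M : matroid E) (e : E) (K : {set E})
    (x y : E) :
  x != y -> x \notin K -> y \notin K ->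
  x |: K \in contraction_faces (IN M) e ->
  y |: K \in deletion_faces (IN M) e :\: contraction_faces (IN M) e ->
  y |: (x |: K) \in indep M.
Proof.
move=> xy xK yK; rewrite in_setD !mem_contraction mem_deletion /=.
move=> /andP[exK IxK] /andP[+ /andP[eyK IyK]]; rewrite eyK /= => nIeyK.
have [|z] := indep_aug IyK IxK.
  by rewrite !cardsU1 exK xK yK.
rewrite !inE negb_or -andbA => /and3P[zy zK /or3P[/eqP ze|/eqP zx|]].
- by rewrite ze (negPf nIeyK).
- by rewrite zx setUCA.
- by rewrite (negPf zK).
Qed.

Theorem theorem3p18 (R : realType) (E : finType) (M : matroid E) (e : E) :
  let D := IN M in
  let q := qvar R in
  let t := tvar R in
  spectrum_poly R D =
    q * spectrum_poly R (deletion D e)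
    + q * t * spectrum_poly R (contraction D e)
    + (1 - q) * spectrum_poly R (del_con_pair D e).
Proof.
move=> D q t; have cardV : #|[set: E] :\ e|.+1 = #|E|.
  by rewrite -cardsT (cardsD1 e [set: E]) in_setT.
have leV : (#|[set: E] :\ e| <= #|E|)%N by rewrite -cardV.
(* All sums are extended to cardinality [#|E|], except that of the contraction, which stops one
   earlier because of its factor t. *)
rewrite (@spectrum_poly_widen _ _ (spair_of_complex D) #|E|) ?cardsT //.
rewrite (@spectrum_poly_widen _ _ (spair_of_complex (deletion D e)) #|E|) //.
rewrite (@spectrum_poly_widen _ _ (del_con_pair D e) #|E|) //.
rewrite (@spectrum_poly_widen _ _ (spair_of_complex (contraction D e)) #|[set:
  E] :\ e|) //.
rewrite cardV; pose B := contraction_faces D e.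
pose b' k : {malg int[qexponent R]} := root_sum (char_poly
  (kmx (level_pred k B) (level_pred k B) (laplace_kernel B))) (@qpow R).
pose chi (P : spair E) k := root_sum (char_poly (laplacian P k)) (@qpow R).
apply: (@poly_sum_recursion _ << qexponent1 >> _ (chi D) (chi (deletion D e))
  (chi (contraction D e)) b' (chi (del_con_pair D e))) => [|k|k];
    rewrite /b' /chi.
- by rewrite level_pred0 /root_sum rootsR_char_poly0 big_nil.
- by rewrite level_predS laplacian_kmx /cells setD0.
have := level_recursion (R := R) (@matroid_exchange _ M e) k.
by rewrite !laplacian_kmx /cells !setD0.
Qed.
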